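(* Let $n,b,c,d,e$ be nonnegative integers. Then \[\sum_{k=0}^n \binom{n}{k}^2\frac{\binom{k+bn}{k}\binom{n+cn}{k}\binom{k+dn}{k}\binom{n+en}{k}}{\binom{n+bn}{k}\binom{k+cn}{k}\binom{n+dn}{k}\binom{k+en}{k}}\Big\{1+(n-2k)\big(2H_k-H_{bn+k}+H_{cn+k}-H_{dn+k}+H_{en+k}\big)\Big\}\] \[= \frac{\binom{1+bn+dn+n}{n}}{\binom{n+bn}{n}\binom{n+dn}{n}}\sum_{\ell=0}^n(-1)^\ell\binom{n}{\ell}\frac{\binom{\ell+bn}{\ell}\binom{\ell+dn}{\ell}\binom{n+cn+en+\ell}{\ell}}{\binom{\ell+cn}{\ell}\binom{\ell+en}{\ell}\binom{1+bn+dn+\ell}{\ell}}.\]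
   Context: $H_0=0$ and $H_m=\sum_{j=1}^m \frac{1}{j}$ for positive integers $m$ (classical harmonic numbers). *)

(* Defs.v *)
From mathcomp Require Export all_boot all_order all_algebra.

Set Implicit Arguments.
Unset Strict Implicit.
Unset Printing Implicit Defensive.

Import GRing.Theory Num.Theory.
Local Open Scope ring_scope.

Definition harmonic (m : nat) : rat := \sum_(1 <= j < m.+1) (j%:R)^-1.

(* The binomial coefficient as a rational number, so that quotients of
   binomials are exact. *)
Definition binq (m k : nat) : rat := 'C(m, k)%:R.

(* Main.v *)
(**
The identity is the derivative at x = 0 of an instance of Whipple's
transformation of a terminating very-well-poised 7F6 series, with
  a = x - n,  b = -n - cn,  c = -n - en,  d = 1 + bn + x,  e = 1 + dn + x
(b, c, d, e on the left being Whipple's letters). At a = x - n the 7F6 equals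
(a)_{n+1} times a 4F3, and (a)_{n+1} contains the factor x, so the derivative
of the right-hand side at 0 is just the value of the cofactor. On the left,
logarithmic differentiation of the k-th term produces the harmonic numbers; the
remaining discrepancy, H_{n-k} in place of -H_k and additive constants, is odd
under k -> n - k and sums to zero.

Whipple's transformation follows Bailey: one quotient of Pochhammer symbols is
expanded by the Pfaff-Saalschuetz theorem, the order of summation is exchanged,
and the inner sum is a well-poised 5F4, itself evaluated by the same expansion
and an orthogonality relation.
*)
Require Import Defs.
From mathcomp Require Import all_boot all_order all_algebra.
From mathcomp Require Import ring lra zify.

Set Implicit Arguments.
Unset Strict Implicit.
Unset Printing Implicit Defensive.

Import Order.TTheory GRing.Theory Num.Theory.
Local Open Scope ring_scope.

(** * Rising factorials and recurrences for binomial coefficients *)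

Section Whipple.
Variable F : numFieldType.
Implicit Types (a b c d e u v x y : F) (k l m n : nat).

Definition poch x k : F := \prod_(0 <= i < k) (x + i%:R).

Lemma poch0 x : poch x 0 = 1.
Proof. by rewrite /poch big_geq. Qed.

Lemma pochS x k : poch x k.+1 = poch x k * (x + k%:R).
Proof. by rewrite /poch big_nat_recr. Qed.

Lemma pochD x m k : poch x (m + k) = poch x m * poch (x + m%:R) k.
Proof.
elim: k => [|k IH]; first by rewrite addn0 poch0 mulr1.
by rewrite addnS !pochS IH natrD addrA mulrA.
Qed.

Lemma pochSl x k : poch x k.+1 = x * poch (x + 1) k.
Proof. by rewrite -add1n pochD pochS poch0 mul1r addr0. Qed.

Lemma poch_neq0_le x k n : (k <= n)%N -> poch x n != 0 -> poch x k != 0.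
Proof. by move=> /subnKC <-; rewrite pochD mulf_eq0 negb_or => /andP[]. Qed.

Lemma poch_gt0 x k : 0 < x -> 0 < poch x k.
Proof.
move=> x0; elim: k => [|k IH]; first by rewrite poch0.
by rewrite pochS mulr_gt0 // ltr_wpDr.
Qed.

Lemma pochN x k : poch (- x) k = (-1) ^+ k * poch (x - k%:R + 1) k.
Proof.
elim: k x => [|k IH] x; first by rewrite !poch0 mulr1.
rewrite pochSl pochS (_ : - x + 1 = - (x - 1)); last by ring.
rewrite IH exprS -natr1 (_ : x - 1 - k%:R + 1 = x - (k%:R + 1) + 1); last by ring.
by ring.
Qed.

Lemma poch_nat n k : poch n.+1%:R k = (n + k)`!%:R / n`!%:R.
Proof.
elim: k => [|k IH]; first by rewrite poch0 addn0 divff // pnatr_eq0 -lt0n fact_gt0.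
rewrite pochS IH -natrD addSn addnS factS natrM; ring.
Qed.

Lemma pochN_nat n k : (k <= n)%N ->
  poch (- n%:R) k = (-1) ^+ k * (n`!%:R / (n - k)`!%:R).
Proof.
move=> /subnK E; rewrite pochN -{1}E natrD addrK natr1 poch_nat E //.
Qed.

(** The subtraction is taken in [F], so the formula also covers [k <= m], where both sides
    vanish. *)
Lemma binS_div k m :
  'C(k, m.+1)%:R = 'C(k, m)%:R * (k%:R - m%:R) / m.+1%:R :> F.
Proof.
apply: (canRL (mulfK _)); first by rewrite pnatr_eq0.
have [le_mk|lt_km] := leqP m k; last by rewrite !bin_small ?mul0r // ltnW.
by rewrite -natrB // -!natrM mulnC mul_bin_left mulnC.
Qed.

Lemma bin_down_div k m :
  'C(k, m)%:R = 'C(k.+1, m)%:R * (k.+1%:R - m%:R) / k.+1%:R :> F.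
Proof.
apply: (canRL (mulfK _)); first by rewrite pnatr_eq0.
have [le_mk|lt_km] := leqP m k.+1.
  by rewrite -natrB // -!natrM mulnC (mul_bin_down k.+1) mulnC.
by rewrite !bin_small ?mul0r // ltnW.
Qed.

(** * The Pfaff-Saalschuetz theorem *)

(* With u = 1 + a - b and v = 1 + a - c, one has u + v - 1 - a = 1 + a - b - c. *)
Definition saal_term a u v k l : F :=
  (-1) ^+ l * 'C(k, l)%:R * poch (a + k%:R) l * poch (u + v - 1 - a) l
  / (poch u l * poch v l).

(** Zeilberger telescoping, by induction on [m]: the truncated sums obey a first-order recurrence in
    [k] up to an explicit remainder. The remainder carries ['C(k, m)], hence vanishes at
    [m = k.+1]. *)
Lemma saal_term_telescope a u v k m : poch u m != 0 -> poch v m != 0 ->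
  (u + k%:R) * (v + k%:R) * (\sum_(0 <= l < m.+1) saal_term a u v k.+1 l)
  - (1 + a - u + k%:R) * (1 + a - v + k%:R)
    * (\sum_(0 <= l < m.+1) saal_term a u v k l)
  = (1 + a + 2%:R * k%:R) * (-1) ^+ m * 'C(k, m)%:R * poch (a + k%:R + 1) m
    * poch (u + v - 1 - a) m.+1 / (poch u m * poch v m).
Proof.
elim: m => [|m IH] Hu Hv.
  by rewrite !big_nat1 /saal_term !bin0 pochS !poch0; field.
move: Hu Hv; rewrite !pochS !mulf_eq0 !negb_or => /andP[Hu Hum] /andP[Hv Hvm].
rewrite !(big_nat_recr m.+1) //= [_ * (_ + saal_term a u v k.+1 _)]mulrDr.
rewrite (canRL (subrK _) (IH Hu Hv)).
move: (\sum_(0 <= l < m.+1) _) => S; rewrite /saal_term.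
rewrite binS natrD (binS_div k m).
rewrite (pochSl (a + k%:R)) (_ : a + k.+1%:R = a + k%:R + 1); last by rewrite -natr1 addrA.
rewrite !pochS !exprS.
have Hm: m%:R + 1 != 0 :> F by rewrite natr1 pnatr_eq0.
rewrite -!natr1; field.
by rewrite Hvm Hv Hum Hu Hm.
Qed.

Lemma saalschutz a u v k : poch u k != 0 -> poch v k != 0 ->
  \sum_(0 <= l < k.+1) saal_term a u v k l
  = poch (1 + a - u) k * poch (1 + a - v) k / (poch u k * poch v k).
Proof.
elim: k => [|k IH] Hu Hv.
  by rewrite big_nat1 /saal_term !poch0 bin0; field.
have := saal_term_telescope a k Hu Hv.
rewrite (bin_small (ltnSn k)) mulr0 !mul0r.
rewrite (big_nat_recr k.+1 0 (saal_term a u v k)) //=.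
have -> : saal_term a u v k k.+1 = 0 by rewrite /saal_term bin_small // mulr0 !mul0r.
rewrite addr0.
move: Hu Hv; rewrite !pochS !mulf_eq0 !negb_or => /andP[Hu Huk] /andP[Hv Hvk].
rewrite IH // => /eqP; rewrite subr_eq0 => /eqP E.
apply: (mulfI (mulf_neq0 Huk Hvk)); rewrite E; field.
by rewrite Hu Hv Huk Hvk.
Qed.

(** An upper limit independent of [k] makes the later double sums rectangular, so that their order
    can be exchanged. *)
Lemma saalschutz_wide a u v k n : (k <= n)%N -> poch u k != 0 -> poch v k != 0 ->
  \sum_(0 <= l < n.+1) saal_term a u v k l
  = poch (1 + a - u) k * poch (1 + a - v) k / (poch u k * poch v k).
Proof.
move=> le_kn Hu Hv; rewrite -saalschutz //.
rewrite (big_cat_nat (n := k.+1)) //= [X in _ + X = _]big_nat_cond [X in _ + X = _]big1 ?addr0 // => l.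
by rewrite andbT => /andP[lt_kl _]; rewrite /saal_term bin_small // mulr0 !mul0r.
Qed.

(** * Well-poised sums up to Whipple's 7F6 transformation *)

(** The factor a + 2k is a times the usual (1+a/2)_k / (a/2)_k. Hence sums come out with (a)_{n+1}
    in place of (1+a)_n, and a = 0 is not excluded. *)
Definition vwp a n k : F :=
  (a + 2%:R * k%:R) * poch a k * poch (- n%:R) k
  / (k`!%:R * poch (1 + a + n%:R) k).

(* Parametrised by u = 1 + a - b and v = 1 + a - c, so that this is
   (b)_k (c)_k / ((1+a-b)_k (1+a-c)_k). *)
Definition wp_ratio a u v k : F :=
  poch (1 + a - u) k * poch (1 + a - v) k / (poch u k * poch v k).

(** Multiplied by n - l, the summand is Gosper-summable in [k]. At [m = n] the closed form contains
    (-n)_{n+1} = 0. *)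
Lemma vwp_telescope a n l m : poch (1 + a + n%:R) m != 0 ->
  (n%:R - l%:R) * (\sum_(0 <= k < m.+1) vwp a n k * ('C(k, l)%:R * poch (a + k%:R) l))
  = - ('C(m, l)%:R * poch a (m + l).+1 * poch (- n%:R) m.+1
       / (m`!%:R * poch (1 + a + n%:R) m)).
Proof.
have E k : vwp a n k * ('C(k, l)%:R * poch (a + k%:R) l) =
    (a + 2%:R * k%:R) * 'C(k, l)%:R * poch a (k + l) * poch (- n%:R) k
    / (k`!%:R * poch (1 + a + n%:R) k).
  by rewrite pochD /vwp; ring.
elim: m => [|m IH] Hm.
  rewrite big_nat1 E; case: l {E} => [|l].
    by rewrite bin0 addn0 fact0 !pochS !poch0; field.
  by rewrite bin0n /=; ring.
move: Hm; rewrite !pochS !mulf_eq0 !negb_or => /andP[Hm Hmm].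
rewrite big_nat_recr //= mulrDr IH // E (bin_down_div m l).
rewrite addSn !pochS factS natrM.
have Hf : m`!%:R != 0 :> F by rewrite pnatr_eq0 -lt0n fact_gt0.
have H1 : m%:R + 1 != 0 :> F by rewrite natr1 pnatr_eq0.
rewrite -!natr1 natrD; field.
by rewrite Hm Hmm Hf H1.
Qed.

(** For l < n the telescoped sum is zero and n - l cancels; for l = n only the term k = n
    survives. *)
Lemma vwp_orthogonality a n l : poch (1 + a + n%:R) n != 0 -> (l <= n)%N ->
  \sum_(0 <= k < n.+1) vwp a n k * ('C(k, l)%:R * poch (a + k%:R) l)
  = if l == n then (-1) ^+ n * poch a n.+1 else 0.
Proof.
move=> Hn le_ln; case: eqP => [->|/eqP ne_ln].
  rewrite big_nat_recr //= big_nat_cond big1 => [|k]; last first.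
    by rewrite andbT => /andP[_ lt_kn]; rewrite bin_small // mul0r mulr0.
  rewrite add0r binn mul1r /vwp pochN_nat // subnn fact0 divr1.
  have Hf : n`!%:R != 0 :> F by rewrite pnatr_eq0 -lt0n fact_gt0.
  (* The factor a + 2n extends (a)_{2n} to (a)_{2n+1}, which is then cut after n + 1 factors. *)
  have E : poch a n * poch (a + n%:R) n * (a + 2%:R * n%:R)
      = poch a n.+1 * poch (1 + a + n%:R) n.
    rewrite -pochD (_ : a + 2%:R * n%:R = a + (n + n)%:R); last by rewrite natrD; ring.
    by rewrite -pochS -addSn pochD -natr1 [1 + a]addrC -addrA [1 + _]addrC.
  transitivity ((-1) ^+ n * (poch a n * poch (a + n%:R) n * (a + 2%:R * n%:R))
     / poch (1 + a + n%:R) n); first by field; rewrite Hn Hf.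
  by rewrite E; field.
have := vwp_telescope l Hn.
rewrite (pochS (- n%:R)) addNr !(mulr0, mul0r) oppr0 => /eqP.
by rewrite mulf_eq0 subr_eq0 eqr_nat eq_sym (negPf ne_ln) => /eqP.
Qed.

(** After the Saalschuetz expansion of [wp_ratio] and the exchange of sums, orthogonality leaves
    only l = n. *)
Lemma well_poised_5F4 a u v n :
  poch (1 + a + n%:R) n != 0 -> poch u n != 0 -> poch v n != 0 ->
  \sum_(0 <= k < n.+1) vwp a n k * wp_ratio a u v k
  = poch a n.+1 * poch (u + v - 1 - a) n / (poch u n * poch v n).
Proof.
move=> Hn Hu Hv.
transitivity (\sum_(0 <= k < n.+1) \sum_(0 <= l < n.+1)
    (-1) ^+ l * poch (u + v - 1 - a) l / (poch u l * poch v l)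
    * (vwp a n k * ('C(k, l)%:R * poch (a + k%:R) l))).
  apply: eq_big_nat => k /andP[_ lt_kn].
  have le_kn : (k <= n)%N by [].
  rewrite /wp_ratio -(saalschutz_wide _ le_kn); try exact: poch_neq0_le le_kn _.
  by rewrite mulr_sumr; apply: eq_bigr => l _; rewrite /saal_term; ring.
rewrite exchange_big /=.
under eq_big_nat => l /andP[_ lt_ln] do rewrite -mulr_sumr vwp_orthogonality //.
rewrite big_nat_recr //= eqxx big_nat_cond big1 => [|l]; last first.
  by rewrite andbT => /andP[_ lt_ln]; rewrite ltn_eqF // mulr0.
(* The sign from the expansion and the sign from orthogonality cancel. *)
rewrite add0r; have S : (-1) ^+ n * (-1) ^+ n = 1 :> F by rewrite -exprMn mulrNN mulr1 expr1n.
set s := (-1) ^+ n in S *.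
transitivity ((s * s) * (poch a n.+1 * poch (u + v - 1 - a) n
  / (poch u n * poch v n))); last by rewrite S mul1r.
by ring.
Qed.

(** Terms with k < l vanish; putting k = l + j gives a multiple of the 5F4 summand with a + 2l, p +
    l, q + l and n - l. *)
Lemma vwp_shifted_5F4 a p q n l :
  poch (1 + a + n%:R) n != 0 -> poch p n != 0 -> poch q n != 0 -> (l <= n)%N ->
  \sum_(0 <= k < n.+1) vwp a n k * wp_ratio a p q k
     * ((-1) ^+ l * 'C(k, l)%:R * poch (a + k%:R) l)
  = poch a n.+1 / (poch p n * poch q n)
    * ('C(n, l)%:R * poch (1 + a - p) l * poch (1 + a - q) l
       * poch (p + q - 1 - a) (n - l)).
Proof.
move=> Hn Hp Hq le_ln.
rewrite (big_cat_nat (n := l)) ?leqW //= big_nat_cond big1 ?add0r => [|k]; last first.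
  by rewrite andbT => /andP[_ lt_kl]; rewrite bin_small //; ring.
rewrite -{1}[l]add0n big_addn subSn //.
have [N EN] : exists N, n = (l + N)%N by exists (n - l)%N; rewrite subnKC.
rewrite EN addKn in Hn Hp Hq *.
have Hf m : m`!%:R != 0 :> F by rewrite pnatr_eq0 -lt0n fact_gt0.
have E1 : 1 + a + (l + N)%:R + l%:R = 1 + (a + l%:R + l%:R) + N%:R by rewrite natrD; ring.
have Dn : poch (1 + a + (l + N)%:R) (l + N)
   = poch (1 + a + (l + N)%:R) l * poch (1 + (a + l%:R + l%:R) + N%:R) N.
  by rewrite pochD E1.
move: Hn Hp Hq; rewrite Dn (pochD p) (pochD q) !mulf_eq0 !negb_or.
move=> /andP[Hn Hn'] /andP[Hp Hp'] /andP[Hq Hq'].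
transitivity (\sum_(0 <= j < N.+1)
   'C(l + N, l)%:R * poch a (l + l) * poch (1 + a - p) l * poch (1 + a - q) l
   / (poch (1 + a + (l + N)%:R) l * poch p l * poch q l)
   * (vwp (a + l%:R + l%:R) N j * wp_ratio (a + l%:R + l%:R) (p + l%:R) (q + l%:R) j)).
  apply: eq_big_nat => j /andP[_ lt_jN]; rewrite /vwp /wp_ratio [(j + l)%N]addnC.
  have Ea : poch a (l + j) * poch (a + (l + j)%:R) l
      = poch a (l + l) * poch (a + l%:R + l%:R) j.
    by rewrite -pochD addnAC (pochD a (l + l)%N) natrD addrA.
  (* The first l factors of (-n)_{l+j} absorb the sign. *)
  have Eb : (-1) ^+ l * poch (- (l + N)%:R) (l + j)
     = (l + N)`!%:R / N`!%:R * poch (- N%:R) j :> F.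
    rewrite pochD pochN_nat ?leq_addr // addKn mulrA mulrA -exprMn mulrNN mulr1 expr1n mul1r.
    by congr (_ * poch _ _); rewrite natrD; ring.
  have Ec : 'C(l + j, l)%:R = (l + j)`!%:R / (l`!%:R * j`!%:R) :> F.
    rewrite -(bin_fact (leq_addr j l)) addKn !natrM mulfK //.
    by rewrite mulf_neq0.
  have Ed : 'C(l + N, l)%:R = (l + N)`!%:R / (l`!%:R * N`!%:R) :> F.
    rewrite -(bin_fact (leq_addr N l)) addKn !natrM mulfK //.
    by rewrite mulf_neq0.
  have Hj x : poch x N != 0 -> poch x j != 0 by apply: poch_neq0_le.
  have /Hj Hpj := Hp'; have /Hj Hqj := Hq'; have /Hj Hnj := Hn'.
  rewrite !(pochD (1 + a + _)) E1 (pochD p) (pochD q).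
  have -> : 1 + (a + l%:R + l%:R) - (p + l%:R) = 1 + a - p + l%:R by ring.
  have -> : 1 + (a + l%:R + l%:R) - (q + l%:R) = 1 + a - q + l%:R by ring.
  have -> : a + 2%:R * (l + j)%:R = a + l%:R + l%:R + 2%:R * j%:R by rewrite natrD; ring.
  rewrite Ec Ed.
  set fk := (l + j)`!%:R; set t := a + _ + _ + _.
  transitivity (t * (poch a (l + j) * poch (a + (l + j)%:R) l)
    * ((-1) ^+ l * poch (- (l + N)%:R) (l + j)) / (l`!%:R * j`!%:R)
    / (poch (1 + a + (l + N)%:R) l * poch (1 + (a + l%:R + l%:R) + N%:R) j)
    * (poch (1 + a - p) l * poch (1 + a - p + l%:R) j
       * (poch (1 + a - q) l * poch (1 + a - q + l%:R) j)
       / (poch p l * poch (p + l%:R) j * (poch q l * poch (q + l%:R) j)))).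
    by field; rewrite Hp Hq Hn Hpj Hqj Hnj !Hf.
  rewrite Ea Eb; field.
  by rewrite Hp Hq Hn Hpj Hqj Hnj !Hf.
rewrite -mulr_sumr well_poised_5F4 //.
rewrite (_ : p + l%:R + (q + l%:R) - 1 - (a + l%:R + l%:R) = p + q - 1 - a); last by ring.
(* Both sides are (a)_{2l+N+1}, cut after 2l or after n + 1 factors. *)
have Ex : poch a (l + l) * poch (a + l%:R + l%:R) N.+1
    = poch a (l + N).+1 * poch (1 + a + (l + N)%:R) l.
  rewrite -[a + l%:R + l%:R]addrA -natrD -pochD.
  rewrite (_ : (l + l + N.+1 = (l + N).+1 + l)%N); last by lia.
  by rewrite pochD -natr1 [1 + a]addrC -addrA [1 + _]addrC.
transitivity (poch a (l + l) * poch (a + l%:R + l%:R) N.+1 * 'C(l + N, l)%:R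
   * poch (1 + a - p) l * poch (1 + a - q) l * poch (p + q - 1 - a) N
   / (poch (1 + a + (l + N)%:R) l * poch p l * poch q l
      * poch (p + l%:R) N * poch (q + l%:R) N)).
  by field; rewrite Hn Hp Hq Hp' Hq'.
by rewrite Ex; field; rewrite Hn Hp Hq Hp' Hq'.
Qed.

(** Only the ratio in u, v is expanded; the one in p, q stays in the inner sum, a shifted 5F4.
    Reversing the symbol of length n - l gives the classical 4F3. *)
Lemma whipple_7F6 a p q u v n :
  poch (1 + a + n%:R) n != 0 -> poch p n != 0 -> poch q n != 0 ->
  poch u n != 0 -> poch v n != 0 ->
  \sum_(0 <= k < n.+1) vwp a n k * wp_ratio a p q k * wp_ratio a u v k
  = poch a n.+1 / (poch p n * poch q n)
    * \sum_(0 <= l < n.+1) 'C(n, l)%:R * poch (1 + a - p) l * poch (1 + a - q) l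
       * poch (p + q - 1 - a) (n - l) * poch (u + v - 1 - a) l
       / (poch u l * poch v l).
Proof.
move=> Hn Hp Hq Hu Hv.
transitivity (\sum_(0 <= k < n.+1) \sum_(0 <= l < n.+1)
    poch (u + v - 1 - a) l / (poch u l * poch v l)
    * (vwp a n k * wp_ratio a p q k * ((-1) ^+ l * 'C(k, l)%:R * poch (a + k%:R) l))).
  apply: eq_big_nat => k /andP[_ lt_kn].
  have le_kn : (k <= n)%N by [].
  rewrite {2}/wp_ratio -(saalschutz_wide _ le_kn); try exact: poch_neq0_le le_kn _.
  by rewrite mulr_sumr; apply: eq_bigr => l _; rewrite /saal_term; ring.
rewrite exchange_big mulr_sumr /=; apply: eq_big_nat => l /andP[_ lt_ln].
by rewrite -mulr_sumr vwp_shifted_5F4 //; ring.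
Qed.
End Whipple.

(** * Algebraic derivatives at 0 of rational functions *)

Section Jets.
Variable F : numFieldType.
Implicit Types (f g : F -> F) (s t w c r x : F) (p q : {poly F}).

(* Off the roots of q, f agrees for 0 < |x| < 1 with the rational function p/q,
   which has value s and derivative t at 0; f 0 itself is irrelevant. *)
Definition jet f s t := exists p q, [/\ q.[0] != 0, p.[0] = s * q.[0],
  p^`().[0] = t * q.[0] + s * q^`().[0]
  & forall x, 0 < `|x| < 1 -> q.[x] != 0 -> f x * q.[x] = p.[x]].

Lemma poly_eq0_near0 p : (forall x, 0 < `|x| < 1 -> p.[x] = 0) -> p = 0.
Proof.
(* The points 1/(i+2) are distinct, lie in the punctured disc, and outnumber the degree. *)
move=> Hp; pose rs := [seq (i.+2%:R : F)^-1 | i <- iota 0 (size p)].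
apply: (@roots_geq_poly_eq0 _ p rs); last by rewrite size_map size_iota.
  apply/allP => _ /mapP[i _ ->]; apply/rootP/Hp.
  rewrite normfV normr_nat invr_gt0 ltr0n /=.
  by rewrite invf_lt1 ?ltr0n // ltr1n.
rewrite map_inj_uniq ?iota_uniq // => i j /invr_inj/eqP.
by rewrite eqr_nat => /eqP[].
Qed.

Lemma eq_jet f g s t : (forall x, 0 < `|x| < 1 -> f x = g x) ->
  jet f s t -> jet g s t.
Proof.
move=> fg [p [q [q0 p0 dp0 H]]]; exists p, q; split=> // x Hx Hq.
by rewrite -fg // H.
Qed.

(** Two fractions representing f cross-multiply to one polynomial identity, which is differentiated
    at 0. *)
Lemma jet_uniq f s s' t t' : jet f s t -> jet f s' t' -> t = t'.
Proof.
move=> [p [q [q0 p0 dp0 H]]] [p' [q' [q0' p0' dp0' H']]].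
have E : p * q' = p' * q.
  (* The factor q * q' covers the roots of the denominators, where [jet] gives no information on
     f. *)
  apply/eqP; rewrite -subr_eq0; have: (p * q' - p' * q) * (q * q') = 0.
    apply: poly_eq0_near0 => x Hx; rewrite !(hornerM, hornerD, hornerN, hornerX, hornerC).
    have [->|nq] := eqVneq q.[x] 0; first by ring.
    have [->|nq'] := eqVneq q'.[x] 0; first by ring.
    by rewrite -H // -H' //; ring.
  have nq : q != 0 by apply: contraNneq q0 => ->; rewrite horner0.
  have nq' : q' != 0 by apply: contraNneq q0' => ->; rewrite horner0.
  by move/eqP; rewrite !mulf_eq0 (negPf nq) (negPf nq') !orbF.
have E0 : p.[0] * q'.[0] = p'.[0] * q.[0] by rewrite -!hornerM E.
have := congr1 (fun h => h^`().[0]) E; rewrite !derivM !(hornerM, hornerD, hornerN, hornerX, hornerC).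
rewrite dp0 dp0' p0 p0'.
have Es : s = s'.
  apply: (mulIf (mulf_neq0 q0 q0')); move: E0; rewrite p0 p0' => E0.
  by rewrite mulrA E0; ring.
rewrite Es => Et; apply: (mulIf (mulf_neq0 q0 q0')).
apply: (addrI (s' * q^`().[0] * q'.[0] + s' * q.[0] * q'^`().[0])).
transitivity ((t * q.[0] + s' * q^`().[0]) * q'.[0] + s' * q.[0] * q'^`().[0]);
  first by ring.
by rewrite Et; ring.
Qed.

Lemma jet_affine c r : jet (fun x => c + r * x) c r.
Proof.
exists (c%:P + r%:P * 'X), 1%:P.
rewrite derivD derivM derivX !derivC !(hornerM, hornerD, hornerX, hornerC, horner0).
split; first exact: oner_neq0.
- by ring.
- by ring.
- by move=> x _ _; rewrite !(hornerM, hornerD, hornerX, hornerC); ring.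
Qed.

Lemma jetD f g s s' t t' : jet f s t -> jet g s' t' ->
  jet (fun x => f x + g x) (s + s') (t + t').
Proof.
move=> [p [q [q0 p0 dp0 H]]] [p' [q' [q0' p0' dp0' H']]].
exists (p * q' + p' * q), (q * q'); split.
- by rewrite hornerM mulf_neq0.
- by rewrite !(hornerM, hornerD, hornerN, hornerX, hornerC) p0 p0'; ring.
- by rewrite !derivE !(hornerM, hornerD, hornerN, hornerX, hornerC) dp0 dp0' p0 p0'; ring.
- move=> x Hx; rewrite !(hornerM, hornerD, hornerN, hornerX, hornerC) mulf_eq0 negb_or => /andP[nq nq'].
  by rewrite -H // -H' //; ring.
Qed.

Lemma jetM f g s s' t t' : jet f s t -> jet g s' t' ->
  jet (fun x => f x * g x) (s * s') (s * t' + t * s').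
Proof.
move=> [p [q [q0 p0 dp0 H]]] [p' [q' [q0' p0' dp0' H']]].
exists (p * p'), (q * q'); split.
- by rewrite hornerM mulf_neq0.
- by rewrite !(hornerM, hornerD, hornerN, hornerX, hornerC) p0 p0'; ring.
- by rewrite !derivE !(hornerM, hornerD, hornerN, hornerX, hornerC) dp0 dp0' p0 p0'; ring.
- move=> x Hx; rewrite !(hornerM, hornerD, hornerN, hornerX, hornerC) mulf_eq0 negb_or => /andP[nq nq'].
  by rewrite -H // -H' //; ring.
Qed.

Lemma jetV f s t : s != 0 -> jet f s t -> jet (fun x => (f x)^-1) s^-1 (- t / s ^+ 2).
Proof.
move=> s0 [p [q [q0 p0 dp0 H]]].
(* The extra q in the denominator restricts the claim to points where f is known. *)
exists (q * q), (p * q); split.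
- by rewrite hornerM p0 !mulf_neq0.
- by rewrite !(hornerM, hornerD, hornerN, hornerX, hornerC) p0; field.
- by rewrite !derivE !(hornerM, hornerD, hornerN, hornerX, hornerC) dp0 p0; field.
- move=> x Hx; rewrite !(hornerM, hornerD, hornerN, hornerX, hornerC) mulf_eq0 negb_or => /andP[np nq].
  have E := H x Hx nq; have nf : f x != 0.
    by apply: contraNneq np => fx0; rewrite -E fx0 mul0r.
  by rewrite -E; field.
Qed.

Lemma jet_sum (f : nat -> F -> F) (s t : nat -> F) n :
  (forall k, (k < n)%N -> jet (f k) (s k) (t k)) ->
  jet (fun x => \sum_(0 <= k < n) f k x)
      (\sum_(0 <= k < n) s k) (\sum_(0 <= k < n) t k).
Proof.
elim: n => [|n IH] H.
  rewrite !big_nil; apply: eq_jet (jet_affine 0 0) => x _.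
  by rewrite big_nil; ring.
rewrite !big_nat_recr //=.
apply: eq_jet (jetD (IH _) (H n _)) => // [x _|k lt_kn].
  by rewrite big_nat_recr.
by apply: H; apply: ltnW.
Qed.

(** Here w is the logarithmic derivative at 0, which is additive over products. *)
Definition logjet f s w := s != 0 /\ jet f s (s * w).

Lemma eq_logjet f g s w : (forall x, 0 < `|x| < 1 -> f x = g x) ->
  logjet f s w -> logjet g s w.
Proof. by move=> fg [s0 Hf]; split=> //; apply: eq_jet Hf. Qed.

Lemma logjet_const c : c != 0 -> logjet (fun=> c) c 0.
Proof.
move=> c0; split=> //; rewrite mulr0; apply: eq_jet (jet_affine c 0) => x _.
by rewrite mul0r addr0.
Qed.

Lemma logjetM f g s s' w w' : logjet f s w -> logjet g s' w' ->
  logjet (fun x => f x * g x) (s * s') (w + w').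
Proof.
move=> [s0 Hf] [s0' Hg]; split; first exact: mulf_neq0.
by rewrite (_ : _ * (_ + _) = s * (s' * w') + s * w * s'); [exact: jetM | ring].
Qed.

Lemma logjetV f s w : logjet f s w -> logjet (fun x => (f x)^-1) s^-1 (- w).
Proof.
move=> [s0 Hf]; split; first by rewrite invr_eq0.
rewrite (_ : _ * - w = - (s * w) / s ^+ 2); first exact: jetV.
by field.
Qed.

Lemma logjet_poch c r k : poch c k != 0 ->
  logjet (fun x => poch (c + r * x) k) (poch c k)
         (r * \sum_(0 <= i < k) (c + i%:R)^-1).
Proof.
elim: k => [|k IH] H.
  split=> //; rewrite big_nil poch0; apply: eq_jet (jet_affine 1 _) => x _.
  by rewrite poch0 !(mulr0, mul0r, addr0).
move: H; rewrite pochS mulf_eq0 negb_or => /andP[H Hk].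
rewrite big_nat_recr //= [r * _]mulrDr.
have H1 : logjet (fun x => c + k%:R + r * x) (c + k%:R) (r * (c + k%:R)^-1).
  by split=> //; rewrite mulrCA divff // mulr1; exact: jet_affine.
apply: eq_logjet (logjetM (IH H) H1) => x _.
by rewrite pochS addrAC.
Qed.

(** The derivative is left unspecified: for a cofactor of x only the value at 0 matters. *)
Definition differentiable f s := exists t, jet f s t.

Lemma eq_differentiable f g s : (forall x, 0 < `|x| < 1 -> f x = g x) ->
  differentiable f s -> differentiable g s.
Proof. by move=> fg [t Hf]; exists t; apply: eq_jet Hf. Qed.

Lemma differentiable_const c : differentiable (fun=> c) c.
Proof.
exists 0; apply: eq_jet (jet_affine c 0) => x _.
by rewrite mul0r addr0.
Qed.

Lemma differentiableM f g s s' : differentiable f s -> differentiable g s' ->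
  differentiable (fun x => f x * g x) (s * s').
Proof. by move=> [t Hf] [t' Hg]; eexists; exact: jetM Hf Hg. Qed.

Lemma differentiableV f s : s != 0 -> differentiable f s ->
  differentiable (fun x => (f x)^-1) s^-1.
Proof. by move=> s0 [t Hf]; eexists; exact: jetV s0 Hf. Qed.

Lemma differentiable_sum (f : nat -> F -> F) (s : nat -> F) n :
  (forall k, (k < n)%N -> differentiable (f k) (s k)) ->
  differentiable (fun x => \sum_(0 <= k < n) f k x) (\sum_(0 <= k < n) s k).
Proof.
elim: n => [|n IH] H.
  rewrite big_nil; apply: eq_differentiable (differentiable_const 0) => x _.
  by rewrite big_nil.
have [t Ht] := IH (fun k lt_kn => H k (ltnW lt_kn)).
have [t' Ht'] := H n (ltnSn n).
exists (t + t'); rewrite big_nat_recr //=; apply: eq_jet (jetD Ht Ht') => x _.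
by rewrite big_nat_recr.
Qed.

Lemma differentiable_poch c r k : differentiable (fun x => poch (c + r * x) k) (poch c k).
Proof.
elim: k => [|k IH].
  by rewrite poch0; apply: eq_differentiable (differentiable_const 1) => x _; rewrite poch0.
have H1 : differentiable (fun x => c + k%:R + r * x) (c + k%:R).
  by exists r; apply: jet_affine.
rewrite pochS; apply: eq_differentiable (differentiableM IH H1) => x _.
by rewrite pochS addrAC.
Qed.
End Jets.

(** * Binomials and harmonic numbers from Pochhammer symbols *)

Lemma natr_fact_neq0 m : m`!%:R != 0 :> rat.
Proof. by rewrite pnatr_eq0 -lt0n fact_gt0. Qed.

Lemma binq_neq0 m k : (k <= m)%N -> binq m k != 0.
Proof. by rewrite /binq pnatr_eq0 -lt0n bin_gt0. Qed.

Lemma binqE m k : (k <= m)%N -> binq m k = m`!%:R / (k`!%:R * (m - k)`!%:R).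
Proof.
move=> le_km; rewrite /binq -(bin_fact le_km) !natrM mulfK //.
by rewrite mulf_neq0 // natr_fact_neq0.
Qed.

Lemma poch_binq m k : poch (1 + m%:R) k = k`!%:R * binq (k + m) k.
Proof.
rewrite addrC natr1 poch_nat binqE ?leq_addr // addKn addnC; field.
by rewrite !natr_fact_neq0.
Qed.

Lemma pochN_binq m k : (k <= m)%N ->
  poch (- m%:R) k = (-1) ^+ k * (k`!%:R * binq m k).
Proof.
move=> le_km; rewrite pochN_nat // binqE //; field.
by rewrite !natr_fact_neq0.
Qed.

Lemma harmonic0 : harmonic 0 = 0.
Proof. by rewrite /harmonic big_geq. Qed.

Lemma harmonicS m : harmonic m.+1 = harmonic m + m.+1%:R^-1.
Proof. by rewrite /harmonic big_nat_recr. Qed.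

Lemma sum_inv_poch m k :
  \sum_(0 <= i < k) (1 + m%:R + i%:R)^-1 = harmonic (m + k) - harmonic m.
Proof.
elim: k => [|k IH]; first by rewrite big_nil addn0 subrr.
rewrite big_nat_recr //= IH addnS harmonicS (_ : (m + k).+1%:R = 1 + m%:R + k%:R).
  by ring.
by rewrite -natr1 natrD; ring.
Qed.

Lemma sum_inv_pochN n k : (k <= n)%N ->
  \sum_(0 <= i < k) (- n%:R + i%:R)^-1 = harmonic (n - k) - harmonic n.
Proof.
elim: k => [|k IH] lt_kn; first by rewrite big_nil subn0 subrr.
rewrite big_nat_recr //= IH ?(ltnW lt_kn) // subnS.
have [m Em] : exists m, (n - k = m.+1)%N.
  by exists (n - k).-1; rewrite prednK // subn_gt0.
have -> : - n%:R + k%:R = - m.+1%:R :> rat.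
  by rewrite -Em natrB ?(ltnW lt_kn) //; ring.
by rewrite Em harmonicS invrN /=; ring.
Qed.

Lemma sum_antisym_eq0 (f : nat -> rat) n :
  (forall k, (k <= n)%N -> f (n - k)%N = - f k) -> \sum_(0 <= k < n.+1) f k = 0.
Proof.
move=> H; set S := \sum_(_ <= _ < _) _.
have : S = - S.
  rewrite {1}/S big_nat_rev /= /S -sumrN; apply: eq_big_nat => k /andP[_ lt_kn].
  by rewrite add0n subSS H.
by move=> E; lra.
Qed.

(** * Differentiating Whipple's transformation at x = 0 *)

Section Derivative.
Variables n B C D E : nat.

Definition weight k : rat :=
  binq n k ^+ 2
  * ((binq (k + B) k * binq (n + C) k * binq (k + D) k * binq (n + E) k)
     / (binq (n + B) k * binq (k + C) k * binq (n + D) k * binq (k + E) k)).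

(** Both sides equal (k+M)! (n-k+M)! / (M! (n+M)!). *)
Lemma binq_ratio_sym M k : (k <= n)%N ->
  binq (n - k + M) (n - k) / binq (n + M) (n - k) = binq (k + M) k / binq (n + M) k.
Proof.
move=> le_kn; rewrite !binqE; try lia.
rewrite !addKn (_ : (n + M - (n - k) = k + M)%N); last by lia.
rewrite (_ : (n + M - k = n - k + M)%N); last by lia.
by field; rewrite !natr_fact_neq0.
Qed.

Lemma weight_ratio k : (k <= n)%N -> weight k =
  binq n k ^+ 2
  * (binq (k + B) k / binq (n + B) k) / (binq (k + C) k / binq (n + C) k)
  * (binq (k + D) k / binq (n + D) k) / (binq (k + E) k / binq (n + E) k).
Proof.
move=> le_kn; rewrite /weight; field.
by rewrite !binq_neq0 //; lia.
Qed.

Lemma weight_sym k : (k <= n)%N -> weight (n - k) = weight k.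
Proof.
move=> le_kn; rewrite !weight_ratio ?leq_subr // !binq_ratio_sym //.
by rewrite /binq bin_sub.
Qed.

(** A symbol (1+M+x)_k contributes H_{M+k} - H_M, and (x-n)_k contributes H_{n-k} - H_n. *)
Definition dlog_weight k : rat :=
  harmonic (n - k) - harmonic n - harmonic k
  + (harmonic (B + k) - harmonic B) + (harmonic (D + k) - harmonic D)
  - (harmonic (C + k) - harmonic C) - (harmonic (E + k) - harmonic E).

Lemma sum_dlog_weight :
  \sum_(0 <= k < n.+1) weight k * (1 + (2%:R * k%:R - n%:R) * dlog_weight k)
  = \sum_(0 <= k < n.+1) weight k
     * (1 + (n%:R - 2%:R * k%:R)
            * (2%:R * harmonic k - harmonic (B + k) + harmonic (C + k)
               - harmonic (D + k) + harmonic (E + k))).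
Proof.
apply/eqP; rewrite -subr_eq0 -sumrB; apply/eqP.
(* The constants and H_{n-k} + H_k are even under k -> n - k, as is [weight]; 2k - n is odd. *)
rewrite (eq_bigr (fun k => weight k * (2%:R * k%:R - n%:R)
   * (harmonic (n - k) + harmonic k
      - (harmonic n + harmonic B + harmonic D - harmonic C - harmonic E)))); last first.
  by move=> k _; rewrite /dlog_weight; ring.
apply: sum_antisym_eq0 => k le_kn; rewrite weight_sym // subKn // natrB //; ring.
Qed.

(* The k-th summand of [whipple_sum] without its factor x - n + 2k. *)
Definition core k (x : rat) : rat :=
  poch (- n%:R) k * poch (- (n + C)%:R) k * poch (- (n + E)%:R) k
  / (k`!%:R * poch (- (n + B)%:R) k * poch (- (n + D)%:R) k)
  * (poch (- n%:R + 1 * x) k * poch (1 + B%:R + 1 * x) k * poch (1 + D%:R + 1 * x) k)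
  * (poch (1 + 0%:R + 1 * x) k * poch (1 + C%:R + 1 * x) k * poch (1 + E%:R + 1 * x) k)^-1.

Lemma poch_nat_neq0 m k : poch (1 + m%:R) k != 0 :> rat.
Proof. by rewrite poch_binq mulf_neq0 ?natr_fact_neq0 // binq_neq0 // leq_addr. Qed.

Lemma pochN_nat_neq0 m k : (k <= m)%N -> poch (- m%:R) k != 0 :> rat.
Proof.
by move=> le_km; rewrite pochN_binq // !mulf_neq0 ?signr_eq0 ?natr_fact_neq0 ?binq_neq0.
Qed.

Lemma core_logjet k : (k <= n)%N -> logjet (core k) (weight k) (dlog_weight k).
Proof.
move=> le_kn.
have lB : (k <= n + B)%N by rewrite (leq_trans le_kn) ?leq_addr.
have lC : (k <= n + C)%N by rewrite (leq_trans le_kn) ?leq_addr.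
have lD : (k <= n + D)%N by rewrite (leq_trans le_kn) ?leq_addr.
have lE : (k <= n + E)%N by rewrite (leq_trans le_kn) ?leq_addr.
have J m := logjet_poch 1 (poch_nat_neq0 m k).
have JN := logjet_poch 1 (pochN_nat_neq0 le_kn).
pose K : rat := poch (- n%:R) k * poch (- (n + C)%:R) k * poch (- (n + E)%:R) k
  / (k`!%:R * poch (- (n + B)%:R) k * poch (- (n + D)%:R) k).
have K0 : K != 0.
  by rewrite !(mulf_neq0, invr_eq0) ?natr_fact_neq0 ?pochN_nat_neq0.
have := logjetM (logjetM (logjet_const K0) (logjetM (logjetM JN (J B)) (J D)))
  (logjetV (logjetM (logjetM (J 0%N) (J C)) (J E))).
set w := (X in logjet _ _ X); have -> : w = dlog_weight k.
  by rewrite /w /dlog_weight !sum_inv_poch sum_inv_pochN // add0n harmonic0; ring.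
set s := (X in logjet _ X _); suff -> : s = weight k by [].
rewrite /s /K !poch_binq !pochN_binq //.
have S : (-1) ^+ k * (-1) ^+ k = 1 :> rat by rewrite -expr2 sqrr_sign.
have bkk : binq (k + 0) k = 1 by rewrite addn0 /binq binn.
rewrite bkk.
have S0 : (-1) ^+ k != 0 :> rat by rewrite signr_eq0.
set sg := (-1) ^+ k in S S0 *.
(* Four symbols with negative argument stand in the numerator and two in the denominator. *)
transitivity (sg * sg * weight k); last by rewrite S mul1r.
rewrite /weight; field.
by rewrite !pnatr_eq0 -!lt0n !bin_gt0 ?leq_addr lB lD fact_gt0 S0.
Qed.

(** In Whipple's letters, p = 1+a-d and q = 1+a-e are free of x, while u = 1+a-b and v = 1+a-c move
    with x. *)
Definition whipple_sum (x : rat) : rat :=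
  \sum_(0 <= k < n.+1)
    vwp (x - n%:R) n k
    * wp_ratio (x - n%:R) (- (n + B)%:R) (- (n + D)%:R) k
    * wp_ratio (x - n%:R) (1 + C%:R + x) (1 + E%:R + x) k.

(** The factor 2k - n + x can vanish at 0 and then has no logarithmic derivative, so it enters
    through the ordinary product rule. *)
Lemma whipple_sum_jet :
  jet whipple_sum (\sum_(0 <= k < n.+1) (2%:R * k%:R - n%:R) * weight k)
    (\sum_(0 <= k < n.+1) weight k * (1 + (2%:R * k%:R - n%:R) * dlog_weight k)).
Proof.
apply: eq_jet; last first.
  apply: (jet_sum (f := fun k x => (2%:R * k%:R - n%:R + 1 * x) * core k x)) => k lt_kn.
  have [_ Jk] := @core_logjet k lt_kn.
  have := jetM (jet_affine (2%:R * k%:R - n%:R) 1) Jk.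
  rewrite [X in jet _ _ X](_ : _ = weight k * (1 + (2%:R * k%:R - n%:R) * dlog_weight k)).
    exact.
  by ring.
move=> x _; apply: eq_big_nat => k _; rewrite /core /vwp /wp_ratio.
rewrite (_ : x - n%:R + 2%:R * k%:R = 2%:R * k%:R - n%:R + 1 * x); last by ring.
rewrite (_ : 1 + (x - n%:R) + n%:R = 1 + 0 + 1 * x); last by ring.
rewrite (_ : 1 + (x - n%:R) - - (n + B)%:R = 1 + B%:R + 1 * x); last by rewrite natrD; ring.
rewrite (_ : 1 + (x - n%:R) - - (n + D)%:R = 1 + D%:R + 1 * x); last by rewrite natrD; ring.
rewrite (_ : 1 + (x - n%:R) - (1 + C%:R + x) = - (n + C)%:R); last by rewrite natrD; ring.
rewrite (_ : 1 + (x - n%:R) - (1 + E%:R + x) = - (n + E)%:R); last by rewrite natrD; ring.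
rewrite (_ : 1 + C%:R + x = 1 + C%:R + 1 * x); last by ring.
rewrite (_ : 1 + E%:R + x = 1 + E%:R + 1 * x); last by ring.
rewrite (_ : x - n%:R = - n%:R + 1 * x); last by ring.
by rewrite !invfM; ring.
Qed.

Definition cofactor (x : rat) : rat :=
  poch (- n%:R + 1 * x) n / (poch (- (n + B)%:R) n * poch (- (n + D)%:R) n)
  * \sum_(0 <= l < n.+1)
      'C(n, l)%:R * (poch (1 + B%:R + 1 * x) l * poch (1 + D%:R + 1 * x) l
      * poch (- (n + B + D).+1%:R + (-1) * x) (n - l)
      * poch (1 + (n + C + E)%:R + 1 * x) l)
      / (poch (1 + C%:R + 1 * x) l * poch (1 + E%:R + 1 * x) l).

(** The last factor of (x-n)_{n+1} is x itself. *)
Lemma whipple_sum_factor x : 0 < `|x| < 1 -> whipple_sum x = (0 + 1 * x) * cofactor x.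
Proof.
move=> /andP[_]; rewrite ltr_norml => /andP[x1 _].
(* Since x > -1, all factors are positive; this gives the nonvanishing hypotheses that involve x. *)
have P m : poch (1 + m%:R + x) n != 0.
  by rewrite gt_eqF // poch_gt0 // -addrA addrCA ltr_wpDl // addrC; lra.
rewrite /whipple_sum whipple_7F6 ?pochN_nat_neq0 ?leq_addr //; last first.
  by rewrite (_ : 1 + (x - n%:R) + n%:R = 1 + 0%:R + x) //; ring.
rewrite /cofactor pochS (_ : x - n%:R + n%:R = x); last by ring.
rewrite !mulr_sumr; apply: eq_bigr => l _.
rewrite (_ : 1 + (x - n%:R) - - (n + B)%:R = 1 + B%:R + 1 * x); last by rewrite natrD; ring.
rewrite (_ : 1 + (x - n%:R) - - (n + D)%:R = 1 + D%:R + 1 * x); last by rewrite natrD; ring.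
rewrite (_ : - (n + B)%:R + - (n + D)%:R - 1 - (x - n%:R) = - (n + B + D).+1%:R + (-1) * x); last by rewrite -natr1 !natrD; ring.
rewrite (_ : 1 + C%:R + x + (1 + E%:R + x) - 1 - (x - n%:R) = 1 + (n + C + E)%:R + 1 * x); last by rewrite !natrD; ring.
rewrite (_ : 1 + C%:R + x = 1 + C%:R + 1 * x); last by ring.
rewrite (_ : 1 + E%:R + x = 1 + E%:R + 1 * x); last by ring.
rewrite (_ : x - n%:R = - n%:R + 1 * x); last by ring.
by rewrite !invfM; ring.
Qed.

Definition cofactor0 : rat :=
  poch (- n%:R) n / (poch (- (n + B)%:R) n * poch (- (n + D)%:R) n)
  * \sum_(0 <= l < n.+1)
      'C(n, l)%:R * (poch (1 + B%:R) l * poch (1 + D%:R) l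
      * poch (- (n + B + D).+1%:R) (n - l) * poch (1 + (n + C + E)%:R) l)
      / (poch (1 + C%:R) l * poch (1 + E%:R) l).

Lemma cofactor_differentiable : differentiable cofactor cofactor0.
Proof.
apply: differentiableM; first by apply: differentiableM; [exact: differentiable_poch|exact: differentiable_const].
apply: differentiable_sum => l _.
apply: differentiableM; last first.
  apply: differentiableV; first by rewrite mulf_neq0 ?poch_nat_neq0.
  by apply: differentiableM; exact: differentiable_poch.
apply: differentiableM; first exact: differentiable_const.
by do !apply: differentiableM; exact: differentiable_poch.
Qed.

(** The derivative of x g(x) at 0 is g(0), and [jet_uniq] equates it with the termwise
    derivative. *)
Lemma sum_weight_cofactor0 :
  \sum_(0 <= k < n.+1) weight k * (1 + (2%:R * k%:R - n%:R) * dlog_weight k)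
  = cofactor0.
Proof.
have [t Jc] := cofactor_differentiable.
have := jetM (jet_affine 0 1) Jc; rewrite mul0r mul0r mul1r add0r => J.
by apply: jet_uniq whipple_sum_jet _; apply: eq_jet J => x /whipple_sum_factor.
Qed.

Lemma cofactor0E : cofactor0 =
  binq (1 + B + D + n) n / (binq (n + B) n * binq (n + D) n)
    * \sum_(0 <= l < n.+1)
        (-1) ^+ l * binq n l
        * ((binq (l + B) l * binq (l + D) l * binq (n + C + E + l) l)
           / (binq (l + C) l * binq (l + E) l * binq (1 + B + D + l) l)).
Proof.
rewrite /cofactor0 !mulr_sumr; apply: eq_big_nat => l /andP[_ lt_ln].
have le_ln : (l <= n)%N by [].
rewrite !poch_binq !pochN_binq ?leq_addr //; last by lia.
(* Both sides are (1+B+D+n)! / (1+B+D)!; this turns the symbol of length n - l into a denominator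
   binomial in l. *)
have E1 : (n - l)`!%:R * binq (n + B + D).+1 (n - l) * l`!%:R * binq (1 + B + D + l) l
    = n`!%:R * binq (1 + B + D + n) n.
  rewrite !binqE; try lia.
  rewrite (_ : ((n + B + D).+1 - (n - l) = 1 + B + D + l)%N); last by lia.
  rewrite !addnK (_ : ((n + B + D).+1 = 1 + B + D + n)%N); last by lia.
  by field; rewrite !natr_fact_neq0.
have bnn : binq n n = 1 by rewrite /binq binn.
have bM : binq (1 + B + D + l) l != 0 by rewrite binq_neq0 // leq_addl.
have -> : (n - l)`!%:R * binq (n + B + D).+1 (n - l)
   = n`!%:R * binq (1 + B + D + n) n / (l`!%:R * binq (1 + B + D + l) l).
  by rewrite -E1; field; rewrite bM natr_fact_neq0.
rewrite bnn [(l + (n + C + E))%N]addnC -/(binq n l).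
have S : (-1) ^+ n = (-1) ^+ (n - l) * (-1) ^+ l :> rat by rewrite -exprD subnK.
rewrite S.
have S0 : (-1) ^+ (n - l) != 0 :> rat by rewrite signr_eq0.
have T0 : (-1) ^+ l != 0 :> rat by rewrite signr_eq0.
have T1 : (-1) ^+ l * (-1) ^+ l = 1 :> rat by rewrite -expr2 sqrr_sign.
set sg := (-1) ^+ (n - l) in S0 *; set tg := (-1) ^+ l in T0 T1 *.
(* The signs on the left reduce to the inverse of (-1)^l. *)
have TV : tg = tg^-1 by apply: (mulfI T0); rewrite T1 divff.
rewrite [X in _ = _ * (X * _ * _)]TV; field.
rewrite ?S0 ?T0 !pnatr_eq0 -?lt0n ?bin_gt0 ?leq_addr ?leq_addl ?fact_gt0 //=.
Qed.

End Derivative.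

Theorem theorem10 (n b c d e : nat) :
  \sum_(0 <= k < n.+1)
     binq n k ^+ 2
     * ((binq (k + b * n) k * binq (n + c * n) k
         * binq (k + d * n) k * binq (n + e * n) k)
        / (binq (n + b * n) k * binq (k + c * n) k
           * binq (n + d * n) k * binq (k + e * n) k))
     * (1 + (n%:R - 2%:R * k%:R)
            * (2%:R * harmonic k - harmonic (b * n + k) + harmonic (c * n + k)
               - harmonic (d * n + k) + harmonic (e * n + k)))
  = binq (1 + b * n + d * n + n) n / (binq (n + b * n) n * binq (n + d * n) n)
    * \sum_(0 <= l < n.+1)
        (-1) ^+ l * binq n l
        * ((binq (l + b * n) l * binq (l + d * n) l
            * binq (n + c * n + e * n + l) l)
           / (binq (l + c * n) l * binq (l + e * n) l
              * binq (1 + b * n + d * n + l) l)).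
Proof.
(* Unification sets [B], [C], [D], [E] to bn, cn, dn, en. *)
by rewrite -cofactor0E -sum_weight_cofactor0 sum_dlog_weight.
Qed.
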